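(* Let $U\subseteq R_{a,b}$ be a basepoint free four-dimensional subspace with basis $\{p_0,p_1,p_2,p_3\}$, where $b\geq 3$, and let $I_U=(p_0,p_1,p_2,p_3)\subseteq R$. Assume that $I_U$ has a first syzygy $Q$ of bidegree $(0,2)$ and no linear first syzygy, and let $V\subseteq U$ be the subspace associated to $Q$. If $\dim_k V=2$, then $I_U$ has two syzygies $S_1,S_2$ of bidegree $(a,b-2)$ such that $\dim_k\langle Q,S_1,S_2\rangle_{2a-1,b-1}=2ab$.
   Context: Let $k$ be an algebraically closed field and $R=k[s,t,u,v]$, bigraded by $\mathrm{bideg}\, s=\mathrm{bideg}\, t=(1,0)$ and $\mathrm{bideg}\, u=\mathrm{bideg}\, v=(0,1)$; $R_{c,d}$ is the bidegree $(c,d)$ component. Here $a\ge 1$. $U$ is basepoint free if $p_0,\dots,p_3$ have no common zero on $\mathbb{P}^1\times\mathbb{P}^1$, equivalently $\sqrt{I_U}=(s,t)\cap(u,v)$. Syzygies: $\mathrm{syz}(I_U)=\{(c_0,\dots,c_3)\in R^4:\sum c_ip_i=0\}$. A (first) syzygy of bidegree $(c,d)$ is a nonzero element of $\mathrm{syz}(I_U)$ all of whose entries lie in $R_{c,d}$. A linear syzygy is one of bidegree $(1,0)$ or $(0,1)$. $\langle\cdots\rangle$ denotes the $R$-submodule of $R^4$ generated by the listed syzygies, and $M_{c,d}=M\cap (R_{c,d})^4$ for a bigraded submodule $M\subseteq R^4$. Subspace $V$: write $Q=(a_iu^2+b_iuv+c_iv^2)_{i=0,\dots,3}$ with $a_i,b_i,c_i\in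 k$, and put $f_0=\sum_i a_ip_i$, $f_1=\sum_i b_ip_i$, $f_2=\sum_i c_ip_i$. Then $V=\mathrm{Span}_k\{f_0,f_1,f_2\}\subseteq U$. *)

(* Defs.v *)
From HB Require Import structures.
From mathcomp Require Import all_boot all_order all_algebra.
From mathcomp Require Import mpoly.
Set Implicit Arguments.
Unset Strict Implicit.
Unset Printing Implicit Defensive.
Import GRing.Theory.
Local Open Scope ring_scope.

(* Linear algebra over [k] in modules that need not be finite-dimensional, such
   as [{mpoly k[4]}]: subspaces are predicates, families are functions on
   ['I_n]. *)
Definition lin_span (k : fieldType) (E : lmodType k) (n : nat) (e : 'I_n -> E)
  : E -> Prop :=
  fun x => exists c : 'I_n -> k, x = \sum_i c i *: e i.

Definition lin_indep (k : fieldType) (E : lmodType k) (n : nat) (e : 'I_n -> E)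
  : Prop :=
  forall c : 'I_n -> k, \sum_i c i *: e i = 0 -> forall i, c i = 0.

Definition lin_basis (k : fieldType) (E : lmodType k) (n : nat)
    (W : E -> Prop) (e : 'I_n -> E) : Prop :=
  lin_indep e /\ (forall x, W x <-> lin_span e x).

Definition has_dim (k : fieldType) (E : lmodType k) (W : E -> Prop) (n : nat)
  : Prop :=
  exists e : 'I_n -> E, lin_basis W e.

(* The ring R = k[s,t,u,v] is [{mpoly k[4]}]; these are the indices of its
   variables. *)
Definition i_s : 'I_4 := @Ordinal 4 0 isT.
Definition i_t : 'I_4 := @Ordinal 4 1 isT.
Definition i_u : 'I_4 := @Ordinal 4 2 isT.
Definition i_v : 'I_4 := @Ordinal 4 3 isT.

(* [bihomog c d f] : f lies in R_{c,d}; it holds for f = 0. *)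
Definition bihomog (k : fieldType) (c d : nat) (f : {mpoly k[4]}) : Prop :=
  forall m, m \in msupp f -> (m i_s + m i_t = c)%N /\ (m i_u + m i_v = d)%N.

(* A point of P^1 x P^1 is given by homogeneous coordinates
   ((x i_s : x i_t), (x i_u : x i_v)), neither pair being zero. *)
Definition basepoint_free (k : fieldType) (p : 'I_4 -> {mpoly k[4]}) : Prop :=
  forall x : 'I_4 -> k,
    (x i_s, x i_t) != (0, 0) -> (x i_u, x i_v) != (0, 0) ->
    exists i, (p i).@[x] != 0.

(* R^4, seen as a k-vector space. *)
Notation free4 k := {ffun 'I_4 -> {mpoly k[4]}}.

Definition is_syzygy (k : fieldType) (p : 'I_4 -> {mpoly k[4]}) (c d : nat)
    (S : free4 k) : Prop :=
  [/\ S <> 0, \sum_i S i * p i = 0 & forall i, bihomog c d (S i)].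

Definition submodule_gen (k : fieldType) (n : nat) (g : 'I_n -> free4 k)
  : free4 k -> Prop :=
  fun x => exists r : 'I_n -> {mpoly k[4]},
    forall i, x i = \sum_j r j * g j i.

Definition bigraded_part (k : fieldType) (M : free4 k -> Prop) (c d : nat)
  : free4 k -> Prop :=
  fun x => M x /\ forall i, bihomog c d (x i).

(* For Q = (a_i u^2 + b_i uv + c_i v^2)_i, the polynomials
   f_0 = \sum a_i p_i, f_1 = \sum b_i p_i, f_2 = \sum c_i p_i:
   f_j uses the coefficients of u^(2-j) v^j in the entries of Q. *)
Definition assoc_poly (k : fieldType) (p : 'I_4 -> {mpoly k[4]}) (Q : free4 k)
    (j : 'I_3) : {mpoly k[4]} :=
  \sum_i (Q i)@_(U_(i_u) *+ (2 - j)%N + U_(i_v) *+ j)%MM *: p i.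

Definition assoc_subspace (k : fieldType) (p : 'I_4 -> {mpoly k[4]})
    (Q : free4 k) : {mpoly k[4]} -> Prop :=
  lin_span (assoc_poly p Q).

(* Main.v *)
(* As dim V = 2, a basis e_0, ..., e_3 of k^4 can be chosen with Q = x e_0 + y e_1
   for binary quadrics x, y.  Put f_j = \sum_i (e_j)_i p_i, so that
   x f_0 + y f_1 = 0.  A linear relation l x + m y = 0 would make (m, -l)
   a linear relation between f_0 and f_1, hence a linear syzygy of I_U.
   So the four cubics ux, vx, uy, vy are independent and span all
   binary cubics.  Writing u^3 and v^3 in terms of x and y yields
   f_0 = q y and f_1 = - q x, and, as b >= 3, f_2 = l_2 y - m_2 x and
   f_3 = l_3 y - m_3 x.  Thus S_1 = (l_2, m_2, -q, 0) and
   S_2 = (l_3, m_3, 0, -q), in the basis (e_j), are syzygies.  Because of the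
   entries -q, the vectors Q, S_1, S_2 are R-independent, so the dimension is
   2a (b - 2) + 2a + 2a = 2ab. *)
Require Import Defs.
From HB Require Import structures.
From mathcomp Require Import all_boot all_order all_algebra.
From mathcomp Require Import mpoly.
From mathcomp Require Import zify ring.
Set Implicit Arguments.
Unset Strict Implicit.
Unset Printing Implicit Defensive.
Import GRing.Theory.
Local Open Scope ring_scope.

(** * Monomials in s, t, u, v and their bidegrees *)

Lemma ord4P (P : 'I_4 -> Prop) :
  P i_s -> P i_t -> P i_u -> P i_v -> forall i, P i.
Proof.
move=> Ps Pt Pu Pv [[|[|[|[|m]]]] lt_m] //.
- by rewrite (_ : Ordinal _ = i_s) //; apply: val_inj.
- by rewrite (_ : Ordinal _ = i_t) //; apply: val_inj.
- by rewrite (_ : Ordinal _ = i_u) //; apply: val_inj.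
- by rewrite (_ : Ordinal _ = i_v) //; apply: val_inj.
Qed.

Definition bideg (m : 'X_{1..4}) : nat * nat :=
  ((m i_s + m i_t)%N, (m i_u + m i_v)%N).

Lemma bidegD m n :
  bideg (m + n)%MM = ((bideg m).1 + (bideg n).1, (bideg m).2 + (bideg n).2)%N.
Proof. by rewrite /bideg !mnmDE /=; congr pair; lia. Qed.

(* The second index is the exponent of v, so that [bmon (ord0, j)] is the
   monomial u^(2-j) v^j of [assoc_poly] when (c, d) = (0, 2). *)
Definition bmon c d (x : 'I_c.+1 * 'I_d.+1) : 'X_{1..4} :=
  [multinom nth 0 [:: (x.1 : nat); c - x.1; d - x.2; (x.2 : nat)]%N i | i < 4].

Lemma bideg_bmon c d (x : 'I_c.+1 * 'I_d.+1) : bideg (bmon x) = (c, d).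
Proof.
by case: x => x y; rewrite /bideg !mnmE /= subnKC ?subnK // -ltnS ltn_ord.
Qed.

Lemma bmon_inj c d : injective (@bmon c d).
Proof.
move=> [x y] [x' y'] /mnmP E; move: (E i_s) (E i_v); rewrite !mnmE /= => *.
by congr pair; apply: val_inj.
Qed.

Lemma bmon_surj c d m : bideg m = (c, d) -> exists x : 'I_c.+1 * 'I_d.+1, m = bmon x.
Proof.
case=> hc hd; have [hx hy] : (m i_s < c.+1 /\ m i_v < d.+1)%N by lia.
exists (Ordinal hx, Ordinal hy).
by apply/mnmP; apply: ord4P; rewrite mnmE /=; lia.
Qed.

(** * Bihomogeneous polynomials and projection to one bidegree *)

Section Bihomogeneous.
Variable k : fieldType.
Implicit Types (f g : {mpoly k[4]}) (m n : 'X_{1..4}).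

Lemma bihomogP c d f :
  bihomog c d f <-> (forall m, f@_m != 0 -> bideg m = (c, d)).
Proof.
split=> h m; first by rewrite -mcoeff_msupp => /h [<- <-].
by rewrite mcoeff_msupp => /h [-> ->].
Qed.

Lemma bihomog0 c d : bihomog c d (0 : {mpoly k[4]}).
Proof. by apply/bihomogP => m; rewrite mcoeff0 eqxx. Qed.

Lemma bihomogD c d f g : bihomog c d f -> bihomog c d g -> bihomog c d (f + g).
Proof.
move=> /bihomogP hf /bihomogP hg; apply/bihomogP => m; rewrite mcoeffD.
have [f0|/hf //] := eqVneq f@_m 0; have [g0|/hg //] := eqVneq g@_m 0.
by rewrite f0 g0 addr0 eqxx.
Qed.

Lemma bihomogZ c d (a : k) f : bihomog c d f -> bihomog c d (a *: f).
Proof.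
move=> /bihomogP hf; apply/bihomogP => m; rewrite mcoeffZ.
by rewrite mulf_eq0 negb_or => /andP[_ /hf].
Qed.

Lemma bihomogN c d f : bihomog c d f -> bihomog c d (- f).
Proof. by rewrite -scaleN1r; apply: bihomogZ. Qed.

Lemma bihomog_sum c d (I : Type) (r : seq I) (P : pred I) (F : I -> {mpoly k[4]}) :
  (forall i, P i -> bihomog c d (F i)) -> bihomog c d (\sum_(i <- r | P i) F i).
Proof.
by move=> h; apply: big_ind => //; [apply: bihomog0 | move=> *; apply: bihomogD].
Qed.

Lemma bihomogX m : bihomog (bideg m).1 (bideg m).2 ('X_[m] : {mpoly k[4]}).
Proof. by move=> n; rewrite msuppX inE => /eqP->. Qed.

Lemma bihomogM c d c' d' f g :
  bihomog c d f -> bihomog c' d' g -> bihomog (c + c') (d + d') (f * g).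
Proof.
move=> hf hg m /msuppM_le /allpairsP [[m1 m2] /= [/hf [<- <-] /hg [<- <-] ->]].
by rewrite !mnmDE; lia.
Qed.

Lemma bihomog_expand c d f :
  bihomog c d f -> f = \sum_(x : 'I_c.+1 * 'I_d.+1) f@_(bmon x) *: 'X_[bmon x].
Proof.
move=> /bihomogP hf; apply/mpolyP => m; rewrite raddf_sum /=.
under eq_bigr do rewrite mcoeffZ mcoeffX.
have [f0|/hf /bmon_surj [x ->]] := eqVneq f@_m 0.
  rewrite f0 big1 // => x _; have [->|] := eqVneq; last by rewrite mulr0.
  by rewrite f0 mul0r.
rewrite (bigD1 x) //= eqxx mulr1 big1 ?addr0 // => y.
by rewrite (inj_eq (@bmon_inj c d)) => /negPf ->; rewrite mulr0.
Qed.

(** Truncated subtraction is harmless here: if f is nonzero, each of its monomials times ['X_[m]]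
    has bidegree (c, d), so [bideg m] is at most (c, d); and 0 lies in every [bihomog]. *)
Lemma bihomog_divX c d m f :
  bihomog c d (f * 'X_[m]) -> bihomog (c - (bideg m).1) (d - (bideg m).2) f.
Proof.
move=> /bihomogP h; apply/bihomogP => n; rewrite -(mcoeffMX f m) => /h.
by rewrite bidegD => -[<- <-]; rewrite !addKn.
Qed.

Lemma mpolyX_divides m f :
  (forall n, n \in msupp f -> (m <= n)%MM) -> exists q, f = q * 'X_[m].
Proof.
move=> h; exists (\sum_(n <- msupp f) f@_n *: 'X_[(n - m)%MM]).
rewrite [LHS]mpolyE mulr_suml big_seq [RHS]big_seq; apply: eq_bigr => n /h le.
by rewrite -scalerAl -mpolyXD submK.
Qed.

(** The k-linear projection of R onto R_{c,d}. It serves to replace the arbitrary coefficients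
    allowed by [submodule_gen] by bihomogeneous ones. *)
Definition bproj c d f : {mpoly k[4]} :=
  \sum_(x : 'I_c.+1 * 'I_d.+1) f@_(bmon x) *: 'X_[bmon x].

Lemma mcoeff_bproj c d f m :
  (bproj c d f)@_m = if bideg m == (c, d) then f@_m else 0.
Proof.
rewrite raddf_sum /=; under eq_bigr do rewrite mcoeffZ mcoeffX.
case: eqP => [/bmon_surj [x ->]|ne].
  rewrite (bigD1 x) //= eqxx mulr1 big1 ?addr0 // => y.
  by rewrite (inj_eq (@bmon_inj c d)) => /negPf ->; rewrite mulr0.
rewrite big1 // => x _; have [E|] := eqVneq; last by rewrite mulr0.
by case: ne; rewrite -E bideg_bmon.
Qed.

Lemma bproj_id c d f : bihomog c d f -> bproj c d f = f.
Proof. by move=> /bihomog_expand. Qed.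

Lemma bproj_eq0 c d c' d' f :
  bihomog c' d' f -> (c', d') != (c, d) -> bproj c d f = 0.
Proof.
move=> /bihomogP h /negPf ne; apply/mpolyP => m; rewrite mcoeff_bproj mcoeff0.
case: eqP => // E; apply/eqP; apply: contraFT ne => /h; by rewrite E => ->.
Qed.

Lemma bproj_sum c d (I : Type) (r : seq I) (F : I -> {mpoly k[4]}) :
  bproj c d (\sum_(i <- r) F i) = \sum_(i <- r) bproj c d (F i).
Proof.
apply/mpolyP => m; rewrite mcoeff_bproj !raddf_sum /=.
under [RHS]eq_bigr do rewrite mcoeff_bproj.
by case: ifP => // _; rewrite big1.
Qed.

Lemma bprojZ c d (a : k) f : bproj c d (a *: f) = a *: bproj c d f.
Proof.
apply/mpolyP => m; rewrite mcoeff_bproj !mcoeffZ mcoeff_bproj.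
by case: ifP => // _; rewrite mulr0.
Qed.

(** By linearity f may be taken to be a monomial; multiplication by g shifts its bidegree by (c',
    d'), so both projections keep it or both kill it. *)
Lemma bprojM c d c' d' f g :
  bihomog c' d' g -> bproj (c + c') (d + d') (f * g) = bproj c d f * g.
Proof.
move=> hg; rewrite (mpolyE f) mulr_suml !bproj_sum mulr_suml.
apply: eq_bigr => m _; rewrite -scalerAl !bprojZ -scalerAl; congr (_ *: _).
have hX := @bihomogX m; have hXg := bihomogM hX hg.
have [E|ne] := eqVneq (bideg m) (c, d).
  by rewrite E in hX hXg; rewrite !bproj_id.
rewrite (bproj_eq0 hX) -?surjective_pairing // mul0r (bproj_eq0 hXg) //.
by apply: contra_neq ne => -[/addIn <- /addIn <-].
Qed.

End Bihomogeneous.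

(** * Dimension of a bigraded part of a free submodule *)

(** Enumerating I allows bases indexed by any finite type, such as the pairs of a generator and a
    monomial used below. *)
Lemma has_dim_fin (k : fieldType) (E : lmodType k) (W : E -> Prop) (I : finType)
    (e : I -> E) :
  (forall c : I -> k, \sum_i c i *: e i = 0 -> forall i, c i = 0) ->
  (forall x, W x <-> exists c : I -> k, x = \sum_i c i *: e i) ->
  has_dim W #|I|.
Proof.
move=> indep span; exists (fun j => e (enum_val j)).
have S (c : I -> k) :
    \sum_i c i *: e i = \sum_(j < #|I|) c (enum_val j) *: e (enum_val j).
  exact: (reindex _ (onW_bij _ (enum_val_bij I))).
split=> [c c0 i|x].
  rewrite -(enum_valK i); apply: (indep (fun i => c (enum_rank i))).
  by rewrite S -[RHS]c0; apply: eq_bigr => j _; rewrite enum_valK.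
rewrite span; split=> -[c ->].
  by exists (fun j => c (enum_val j)); rewrite S.
exists (fun i => c (enum_rank i)); rewrite S.
by apply: eq_bigr => j _; rewrite enum_valK.
Qed.

Section FreeSubmodule.
Variables (k : fieldType) (n : nat) (g : 'I_n -> free4 k).
Variables (c d : 'I_n -> nat).
Hypothesis g_free : forall r : 'I_n -> {mpoly k[4]},
  (forall i, \sum_j r j * g j i = 0) -> forall j, r j = 0.

(** A basis is given by the products of each g_j with the monomials of bidegree (c'_j, d'_j), the
    bidegree that completes that of g_j to (c0, d0). There are (c'_j + 1)(d'_j + 1) such monomials,
    and freeness of g makes the products independent. *)
Lemma has_dim_free_submodule c0 d0 (c' d' : 'I_n -> nat) :
  (forall j i, bihomog (c j) (d j) (g j i)) ->
  (forall j, (c' j + c j = c0)%N) -> (forall j, (d' j + d j = d0)%N) ->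
  has_dim (bigraded_part (submodule_gen g) c0 d0)
          (\sum_j (c' j).+1 * (d' j).+1)%N.
Proof.
move=> hg hc hd.
pose J j : finType := ('I_(c' j).+1 * 'I_(d' j).+1)%type.
pose e (w : {j : 'I_n & J j}) : free4 k :=
  [ffun i => 'X_[bmon (tagged w)] * g (tag w) i].
have -> : (\sum_j (c' j).+1 * (d' j).+1 = #|{: {j : 'I_n & J j}}|)%N.
  rewrite card_tagged sumnE big_map big_enum; apply: eq_bigr => j _.
  by rewrite card_prod !card_ord.
have sumE (z : {j : 'I_n & J j} -> k) i : (\sum_w z w *: e w) i =
    \sum_j (\sum_(x : J j) z (Tagged J x) *: 'X_[bmon x]) * g j i.
  rewrite sum_ffunE (eq_bigr (fun j => \sum_(x : J j)
    z (Tagged J x) *: ('X_[bmon x] * g j i))); last first.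
    by move=> j _; rewrite mulr_suml; apply: eq_bigr => x _; rewrite scalerAl.
  rewrite (sig_big_dep _ (fun _ _ => true)
    (fun j (x : J j) => z (Tagged J x) *: ('X_[bmon x] * g j i))) /=.
  by apply: eq_bigr => -[j x] _; rewrite !ffunE.
apply: (has_dim_fin (e := e)) => [z z0 [j x]|f].
  have r0 : \sum_(y : J j) z (Tagged J y) *: 'X_[bmon y] = 0 :> {mpoly k[4]}.
    apply: (g_free (r := fun j => \sum_(y : J j) z (Tagged J y) *: 'X_[bmon y])).
    by move=> i; rewrite -sumE z0 ffunE.
  have := congr1 (mcoeff (bmon x)) r0.
  rewrite mcoeff0 raddf_sum (bigD1 x) //= mcoeffZ mcoeffX eqxx mulr1.
  rewrite big1 ?addr0 // => y ne.
  by rewrite mcoeffZ mcoeffX (inj_eq (@bmon_inj _ _)) (negPf ne) mulr0.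
split=> [[[r fE] hf]|[z ->]].
  (* Projecting x = sum of r_j g_j to bidegree (c0, d0) leaves x fixed and cuts each r_j down to its
     component of bidegree (c'_j, d'_j). *)
  exists (fun w => (r (tag w))@_(bmon (tagged w))).
  apply/ffunP => i; rewrite sumE -(bproj_id (hf i)) fE bproj_sum.
  by apply: eq_bigr => j _; rewrite -(hc j) -(hd j) bprojM.
split=> [|i]; first by eexists => i; apply: sumE.
rewrite sumE; apply: bihomog_sum => j _; rewrite -(hc j) -(hd j).
apply: bihomogM (hg j i); apply: bihomog_sum => x _; apply: bihomogZ.
by have := @bihomogX k (bmon x); rewrite bideg_bmon.
Qed.
End FreeSubmodule.

(** * Binary forms in u, v and relations with quadric coefficients *)

Section BinaryForms.
Variable k : fieldType.
Implicit Types f l m w x y : {mpoly k[4]}.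

Lemma binary_form_expand d f : bihomog 0 d f ->
  f = \sum_(j < d.+1) f@_(bmon (ord0 : 'I_1, j)) *: 'X_[bmon (ord0 : 'I_1, j)].
Proof.
move=> /bihomog_expand {1}->.
rewrite -(pair_bigA _ (fun i j => f@_(bmon (i, j)) *: 'X_[bmon (i, j)])) /=.
by rewrite big_ord1.
Qed.

(** Binary forms of degree d have d + 1 coefficients, so the coefficient matrix M of d + 1
    independent forms is square with trivial left kernel, hence invertible; the coordinates of w
    come from its inverse. *)
Lemma binary_forms_span d (g : 'I_d.+1 -> {mpoly k[4]}) w :
  (forall i, bihomog 0 d (g i)) -> lin_indep g -> bihomog 0 d w -> lin_span g w.
Proof.
move=> hg indep hw; pose e (j : 'I_d.+1) : 'X_{1..4} := bmon (ord0 : 'I_1, j).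
pose M : 'M[k]_d.+1 := \matrix_(i, j) (g i)@_(e j).
have gE (c : 'rV[k]_d.+1) :
    \sum_i c 0 i *: g i = \sum_j (c *m M) 0 j *: 'X_[e j].
  under [RHS]eq_bigr do rewrite mxE scaler_suml.
  rewrite exchange_big; apply: eq_bigr => i _.
  rewrite [in LHS](binary_form_expand (hg i)) scaler_sumr.
  by apply: eq_bigr => j _; rewrite mxE scalerA.
have Mfree : row_free M.
  apply/row_freeP/row_freeP; rewrite -kermx_eq0; apply/rowV0P => c /sub_kermxP cM.
  apply/rowP => i; rewrite mxE; apply: (indep (c 0)).
  by rewrite gE cM big1 // => j _; rewrite mxE scale0r.
pose c : 'rV_d.+1 := (\row_j w@_(e j)) *m invmx M.
exists (c 0); rewrite gE mulmxKV -?row_free_unit // {1}(binary_form_expand hw).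
by apply: eq_bigr => j _; rewrite mxE.
Qed.

Lemma bihomogXu : bihomog 0 1 ('X_i_u : {mpoly k[4]}).
Proof. by have := @bihomogX k U_(i_u); rewrite /bideg !mnm1E. Qed.

Lemma bihomogXv : bihomog 0 1 ('X_i_v : {mpoly k[4]}).
Proof. by have := @bihomogX k U_(i_v); rewrite /bideg !mnm1E. Qed.

Lemma linear_form_eq0 (a b : k) :
  a *: 'X_i_u + b *: 'X_i_v = 0 :> {mpoly k[4]} -> a = 0 /\ b = 0.
Proof.
move=> E; split; [have := congr1 (mcoeff U_(i_u)) E | have := congr1 (mcoeff U_(i_v)) E];
  by rewrite mcoeff0 mcoeffD !mcoeffZ !mcoeffXU !eqxx /= !(mulr0, mulr1, addr0, add0r).
Qed.

(** The absence of linear relations between x and y says that ux, vx, uy, vy are independent, and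
    binary cubics form a space of dimension 4. *)
Lemma cubic_combination x y w :
  bihomog 0 2 x -> bihomog 0 2 y ->
  (forall l m, bihomog 0 1 l -> bihomog 0 1 m -> l * x + m * y = 0 ->
     l = 0 /\ m = 0) ->
  bihomog 0 3 w ->
  exists l m, [/\ bihomog 0 1 l, bihomog 0 1 m & w = l * x + m * y].
Proof.
move=> hx hy indep hw.
have hl (a b : k) : bihomog 0 1 (a *: 'X_i_u + b *: 'X_i_v : {mpoly k[4]}).
  by apply: bihomogD; apply: bihomogZ; [apply: bihomogXu | apply: bihomogXv].
pose g := tnth [tuple 'X_i_u * x; 'X_i_v * x; 'X_i_u * y; 'X_i_v * y].
have gE (c : 'I_4 -> k) : \sum_i c i *: g i =
    (c i_s *: 'X_i_u + c i_t *: 'X_i_v) * x + (c i_u *: 'X_i_u + c i_v *: 'X_i_v) * y.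
  rewrite !big_ord_recl big_ord0 addr0 !mulrDl -!scalerAl addrA.
  do !congr (_ + _); by congr (c _ *: _); apply: val_inj.
have [|c|c ->] := @binary_forms_span 3 g w _ _ hw.
- by apply: ord4P; rewrite /g (tnth_nth 0) /=;
    [ apply: (bihomogM bihomogXu hx) | apply: (bihomogM bihomogXv hx)
    | apply: (bihomogM bihomogXu hy) | apply: (bihomogM bihomogXv hy) ].
- rewrite gE => /indep [||/linear_form_eq0 [? ?] /linear_form_eq0 [? ?]];
    try exact: hl.
  exact: ord4P.
by exists (c i_s *: 'X_i_u + c i_t *: 'X_i_v), (c i_u *: 'X_i_u + c i_v *: 'X_i_v).
Qed.

(** Each monomial of w has degree at least 3 in u, v, so it has a binary cubic monomial as a factor,
    to which the hypothesis on cubics applies. *)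
Lemma combination_ge3 a b x y w :
  (forall w', bihomog 0 3 w' ->
   exists l m, [/\ bihomog 0 1 l, bihomog 0 1 m & w' = l * x + m * y]) ->
  (3 <= b)%N -> bihomog a b w ->
  exists l m, [/\ bihomog a (b - 2) l, bihomog a (b - 2) m & w = l * x + m * y].
Proof.
move=> cubic b3 hw; rewrite [w]mpolyE big_seq.
apply: (big_ind (fun f => exists l m,
  [/\ bihomog a (b - 2) l, bihomog a (b - 2) m & f = l * x + m * y])).
- by exists 0, 0; split; [apply: bihomog0 .. | rewrite !mul0r addr0].
- move=> _ _ [l1 [m1 [hl1 hm1 ->]]] [l2 [m2 [hl2 hm2 ->]]].
  exists (l1 + l2), (m1 + m2); split; [exact: bihomogD .. |].
  by rewrite !mulrDl addrACA.
move=> n /hw [na nb].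
have [q [r [nE qu rv]]] : exists q r : 'X_{1..4},
    [/\ n = (q + r)%MM, bideg q = (a, b - 3)%N & bideg r = (0, 3)%N].
  (* The cubic factor r takes up to three factors u and is filled up with v; enough factors v remain
     because b is at least 3. *)
  have [le|lt] := leqP 3 (n i_u).
    exists (n - U_(i_u) *+ 3)%MM, (U_(i_u) *+ 3)%MM.
    rewrite /bideg !mnmBE !mulmnE !mnm1E /=; split; [|congr pair; lia|by []].
    apply/mnmP; apply: ord4P; rewrite !mnmDE !mnmBE !mulmnE !mnm1E /=; lia.
  pose r : 'X_{1..4} := (U_(i_u) *+ n i_u + U_(i_v) *+ (3 - n i_u))%MM.
  exists (n - r)%MM, r.
  rewrite /bideg !mnmBE !mnmDE !mulmnE !mnm1E /=; split; [|congr pair; lia|congr pair; lia].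
  apply/mnmP; apply: ord4P; rewrite !mnmDE !mnmBE !mnmDE !mulmnE !mnm1E /=; lia.
have [|l [m [hl hm rE]]] := cubic 'X_[r].
  by have := @bihomogX k r; rewrite rv.
have hq : bihomog a (b - 3) (w@_n *: 'X_[q] : {mpoly k[4]}).
  by apply: bihomogZ; have := @bihomogX k q; rewrite qu.
exists (w@_n *: 'X_[q] * l), (w@_n *: 'X_[q] * m).
have [a0 b2] : (a + 0 = a /\ b - 3 + 1 = b - 2)%N by lia.
split; [rewrite -a0 -b2; exact: bihomogM .. |].
by rewrite nE mpolyXD rE -!mulrA -mulrDr scalerAl.
Qed.

(** A monomial of f times v^d occurs in g u^d, so its exponent of u is at least d; the factor v^d
    contributes nothing to that exponent. *)
Lemma power_divides (d : nat) f g :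
  f * 'X_i_v ^+ d = g * 'X_i_u ^+ d -> exists q, f = q * 'X_[U_(i_u) *+ d].
Proof.
rewrite !mpolyXn => E; apply: mpolyX_divides => n nf.
have : (U_(i_v) *+ d + n)%MM \in msupp (f * 'X_[U_(i_v) *+ d]).
  by rewrite mcoeff_msupp mcoeffMX -mcoeff_msupp.
rewrite E (perm_mem (msuppMX _ _)) => /mapP [n' _ /mnmP nE].
apply/mnm_lepP; apply: ord4P; rewrite mulmnE mnm1E //=.
by have := nE i_u; rewrite !mnmDE !mulmnE !mnm1E /=; lia.
Qed.

Lemma quadric_syzygy a b x y f0 f1 :
  bihomog 0 2 x -> bihomog 0 2 y -> bihomog a b f0 -> bihomog a b f1 ->
  x != 0 -> y != 0 -> x * f0 + y * f1 = 0 ->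
  (forall l m, bihomog 0 1 l -> bihomog 0 1 m -> l * f0 + m * f1 = 0 ->
     l = 0 /\ m = 0) ->
  (forall w, bihomog 0 3 w ->
   exists l m, [/\ bihomog 0 1 l, bihomog 0 1 m & w = l * y - m * x])
  /\ exists q, [/\ bihomog a (b - 2) q, f0 = q * y & f1 = - (q * x)].
Proof.
move=> hx hy hf0 hf1 nx ny xy indep.
have cubic w : bihomog 0 3 w ->
    exists l m, [/\ bihomog 0 1 l, bihomog 0 1 m & w = l * y - m * x].
  move=> hw; have [||l m hl hm lm||l [m [hl hm ->]]] := @cubic_combination y (- x) w => //.
  - exact: bihomogN.
  (* R is a domain, so it is enough that x (l f0 + m f1) vanishes; it is a combination of the two
     given relations. *)
  - apply: indep => //; apply: (mulfI nx).
    have -> : x * (l * f0 + m * f1) = l * (x * f0 + y * f1) - f1 * (l * y + m * - x).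
      by ring.
    by rewrite xy lm !mulr0 subr0.
  by exists l, m; split; rewrite // mulrN.
split=> //.
(* Modulo x f_0 + y f_1 = 0, multiplication of f_0 by any element of (x, y)
   lands in (y). *)
have key (w l m : {mpoly k[4]}) : w = l * y - m * x -> w * f0 = y * (l * f0 + m * f1).
  move=> ->; have -> : (l * y - m * x) * f0 =
    y * (l * f0 + m * f1) - m * (x * f0 + y * f1) by ring.
  by rewrite xy mulr0 subr0.
have hu3 : bihomog 0 3 ('X_i_u ^+ 3 : {mpoly k[4]}).
  by apply: (bihomogM bihomogXu); apply: (bihomogM bihomogXu); apply: bihomogXu.
have hv3 : bihomog 0 3 ('X_i_v ^+ 3 : {mpoly k[4]}).
  by apply: (bihomogM bihomogXv); apply: (bihomogM bihomogXv); apply: bihomogXv.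
have [l [m [hl hm /key uE]]] := cubic _ hu3.
have [l' [m' [hl' hm' /key vE]]] := cubic _ hv3.
(* With g = l f0 + m f1 and g' = l' f0 + m' f1, one has u^3 f0 = y g and v^3 f0 = y g'. Cancelling y
   gives g v^3 = g' u^3, so g = q u^3, and then f0 = q y. *)
have [|q qE] := @power_divides 3 (l * f0 + m * f1) (l' * f0 + m' * f1).
  by apply: (mulfI ny); rewrite !mulrA -uE -vE; ring.
have f0E : f0 = q * y.
  have nu : 'X_[U_(i_u) *+ 3] != 0 :> {mpoly k[4]} by rewrite -msupp_eq0 msuppX.
  by apply: (mulfI nu); rewrite -{1}mpolyXn uE qE; ring.
exists q; split=> //.
  have := @bihomog_divX k (0 + a) (1 + b) (U_(i_u) *+ 3) q.
  (* The product q u^3 has bidegree (a, b + 1), so q has bidegree (a, b - 2). *)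
  rewrite -qE /bideg !mulmnE !mnm1E /= (_ : 1 + b - 3 = b - 2)%N ?subn0; last by lia.
  by apply; apply: bihomogD; apply: bihomogM.
apply: (mulfI ny); move: xy; rewrite f0E => /eqP.
by rewrite addrC addr_eq0 => /eqP ->; ring.
Qed.
End BinaryForms.

(** * Rank of a coefficient matrix and dimension of the span *)

(** Let C write f in terms of a basis e of the span, and D write e in terms of f. Then D A has d
    independent rows and A = C (D A), so the rank of A is at least d and at most d. *)
Lemma has_dim_lin_span_mx (k : fieldType) (E : lmodType k) (m n d : nat)
    (p : 'I_n -> E) (A : 'M[k]_(m, n)) (f : 'I_m -> E) :
  lin_indep p -> (forall j, f j = \sum_i A j i *: p i) ->
  has_dim (lin_span f) d -> \rank A = d.
Proof.
move=> p_indep fE [e [e_indep e_span]].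
have [C CE] : exists C : 'I_m -> 'I_d -> k, forall j, f j = \sum_l C j l *: e l.
  apply: (fin_all_exists (P := fun j (c : 'I_d -> k) => f j = \sum_l c l *: e l)) => j.
  apply/e_span; exists (fun i => (i == j)%:R).
  rewrite (bigD1 j) //= eqxx scale1r big1 ?addr0 // => i /negPf ->.
  by rewrite scale0r.
have [D DE] : exists D : 'I_d -> 'I_m -> k, forall l, e l = \sum_j D l j *: f j.
  apply: (fin_all_exists (P := fun l (c : 'I_m -> k) => e l = \sum_j c j *: f j)) => l.
  apply/e_span; exists (fun i => (i == l)%:R).
  rewrite (bigD1 l) //= eqxx scale1r big1 ?addr0 // => i /negPf ->.
  by rewrite scale0r.
have combE (r s : nat) (X : 'M[k]_(r, s)) (Y : 'M[k]_(s, n)) (h : 'I_s -> E) i :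
    (forall j, h j = \sum_l Y j l *: p l) ->
    \sum_j X i j *: h j = \sum_l (X *m Y) i l *: p l.
  move=> hE; under [RHS]eq_bigr do rewrite mxE scaler_suml.
  rewrite exchange_big; apply: eq_bigr => j _; rewrite hE scaler_sumr.
  by apply: eq_bigr => l _; rewrite scalerA.
pose Cm : 'M_(m, d) := \matrix_(j, l) C j l.
pose Dm : 'M_(d, m) := \matrix_(l, j) D l j.
have eE l : e l = \sum_i (Dm *m A) l i *: p i.
  rewrite DE -(combE _ _ Dm A f l fE).
  by apply: eq_bigr => j _; rewrite mxE.
have DAfree : row_free (Dm *m A).
  rewrite -kermx_eq0; apply/rowV0P => c /sub_kermxP cE.
  apply/rowP => l; rewrite mxE; apply: (e_indep (c 0)).
  by rewrite (combE _ _ c (Dm *m A) e 0 eE) cE big1 // => i _; rewrite mxE scale0r.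
(* Both sides hold coordinates of f with respect to p, and these are unique. *)
have AE : A = Cm *m (Dm *m A).
  apply/matrixP => j i; apply/eqP; rewrite -subr_eq0; apply/eqP; move: i.
  apply: p_indep; under eq_bigr do rewrite scalerBl.
  rewrite sumrB -fE -(combE _ _ Cm (Dm *m A) e j eE) CE.
  by apply/eqP; rewrite subr_eq0; apply/eqP/eq_bigr => l _; rewrite mxE.
apply/eqP; rewrite eqn_leq; apply/andP; split.
  by rewrite AE (leq_trans (mxrankM_maxl _ _)) ?rank_leq_col.
by rewrite -{1}(eqP DAfree) mxrankM_maxr.
Qed.

(** * Constant change of basis in the free module of rank 4 *)

Section ConstantChange.
Variables (k : fieldType) (P : 'M[k]_4).
Implicit Types z : 'I_4 -> {mpoly k[4]}.

(** The rows of P are the vectors e_j of the new basis; z lists the coordinates in that basis, and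
    [change z] is the vector sum of z_j e_j. *)
Definition change z : free4 k := [ffun i => \sum_j P j i *: z j].

Lemma change_eq0 z : P \in unitmx -> (forall i, change z i = 0) -> forall j, z j = 0.
Proof.
move=> Pu z0 l; transitivity (\sum_i invmx P i l *: change z i); last first.
  by rewrite big1 // => i _; rewrite z0 scaler0.
under eq_bigr do rewrite ffunE scaler_sumr.
rewrite exchange_big /= (eq_bigr (fun j => (1%:M : 'M_4) j l *: z j)).
  rewrite (bigD1 l) //= mxE eqxx scale1r big1 ?addr0 // => j /negPf ne.
  by rewrite mxE ne scale0r.
move=> j _; rewrite -(mulmxV Pu) mxE scaler_suml.
by apply: eq_bigr => i _; rewrite scalerA mulrC.
Qed.

(** Moves the change of basis from the syzygy to the generators: relations can be checked on the new
    generators f_j, the sums of [P j i *: p i]. *)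
Lemma change_pairing z (p : 'I_4 -> {mpoly k[4]}) :
  \sum_i change z i * p i = \sum_j z j * (\sum_i P j i *: p i).
Proof.
under eq_bigr do rewrite ffunE mulr_suml.
rewrite exchange_big; apply: eq_bigr => j _; rewrite mulr_sumr.
by apply: eq_bigr => i _; rewrite -scalerAl scalerAr.
Qed.

Lemma change_sum n (r : 'I_n -> {mpoly k[4]}) (z : 'I_n -> 'I_4 -> {mpoly k[4]}) i :
  \sum_j r j * change (z j) i = change (fun l => \sum_j r j * z j l) i.
Proof.
under eq_bigr do rewrite ffunE mulr_sumr.
rewrite ffunE exchange_big; apply: eq_bigr => l _; rewrite scaler_sumr.
by apply: eq_bigr => j _; rewrite scalerAr.
Qed.

Lemma bihomog_change c d z :
  (forall j, bihomog c d (z j)) -> forall i, bihomog c d (change z i).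
Proof.
by move=> hz i; rewrite ffunE; apply: bihomog_sum => j _; apply: bihomogZ.
Qed.

Lemma is_syzygy_change c d (p : 'I_4 -> {mpoly k[4]}) z j :
  P \in unitmx -> z j != 0 -> (forall j, bihomog c d (z j)) ->
  \sum_j z j * (\sum_i P j i *: p i) = 0 -> is_syzygy p c d (change z).
Proof.
move=> Pu /eqP zj hz z0; split; [|by rewrite change_pairing|exact: bihomog_change].
by move=> S0; apply: zj; apply: change_eq0 Pu _ j => i; rewrite S0 ffunE.
Qed.
End ConstantChange.

(** * Normal form of Q and construction of the two syzygies *)

Lemma assoc_monomial (j : 'I_3) :
  (U_(i_u) *+ (2 - j)%N + U_(i_v) *+ j)%MM = bmon (ord0 : 'I_1, j).
Proof.
by apply/mnmP; apply: ord4P; rewrite mnmDE !mulmnE !mnm1E mnmE /=; lia.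
Qed.

Lemma sum4E (V : nmodType) (F : 'I_4 -> V) :
  \sum_i F i = F i_s + F i_t + F i_u + F i_v.
Proof.
rewrite !big_ord_recl big_ord0 addr0 !addrA.
by do !congr (_ + _); congr F; apply: val_inj.
Qed.

Theorem theorem4p3 (k : closedFieldType) (a b : nat)
    (U : {mpoly k[4]} -> Prop) (p : 'I_4 -> {mpoly k[4]}) (Q : free4 k)
    (ha : (1 <= a)%N) (hb : (3 <= b)%N)
    (hU : forall f, U f -> bihomog a b f)
    (hp : lin_basis U p)
    (hbpf : basepoint_free p)
    (hQ : is_syzygy p 0 2 Q)
    (hlin : forall L : free4 k, ~ is_syzygy p 1 0 L /\ ~ is_syzygy p 0 1 L)
    (hV : has_dim (assoc_subspace p Q) 2) :
  exists S1 S2 : free4 k,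
    [/\ is_syzygy p a (b - 2)%N S1,
        is_syzygy p a (b - 2)%N S2 &
        has_dim (bigraded_part
                   (submodule_gen (tnth [tuple Q; S1; S2]))
                   (2 * a - 1)%N (b - 1)%N)
                (2 * a * b)%N].
Proof.
have [[p_indep p_span] [Q0 Qp hQ2]] := (hp, hQ).
have hpi i : bihomog a b (p i).
  apply/hU/p_span; exists (fun j => (j == i)%:R).
  rewrite (bigD1 i) //= eqxx scale1r big1 ?addr0 // => j /negPf ->.
  by rewrite scale0r.
(* The rows of A are the coordinates of the three polynomials spanning V, so the rank of A is dim V
   = 2. *)
pose A : 'M[k]_(3, 4) := \matrix_(j, i) (Q i)@_(bmon (ord0 : 'I_1, j)).
have rankA : \rank A = 2.
  apply: (has_dim_lin_span_mx p_indep _ hV) => j.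
  by apply: eq_bigr => i _; rewrite assoc_monomial mxE.
(* In the factorization A = [col_ebase A *m pid_mx 2 *m row_ebase A], the middle factor keeps only
   the first two rows of P. So Q involves only the first two new basis vectors, with quadric
   coordinates [z i_s] and [z i_t], the x and y of the outline. *)
pose P := row_ebase A; have Pu : P \in unitmx := row_ebase_unit A.
pose B : 'M_(3, 4) := col_ebase A *m pid_mx 2.
have AE : A = B *m P by rewrite -[LHS]mulmx_ebase rankA.
pose z l : {mpoly k[4]} := \sum_j B j l *: 'X_[bmon (ord0 : 'I_1, j)].
have QE : Q = change P z.
  apply/ffunP => i; rewrite ffunE [LHS](binary_form_expand (hQ2 i)).
  under [RHS]eq_bigr do rewrite scaler_sumr.
  rewrite exchange_big; apply: eq_bigr => j _.
  have -> : (Q i)@_(bmon (ord0 : 'I_1, j)) = A j i by rewrite mxE.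
  rewrite AE mxE scaler_suml; apply: eq_bigr => l _.
  by rewrite scalerA mulrC.
have hz l : bihomog 0 2 (z l).
  apply: bihomog_sum => j _; apply: bihomogZ.
  by have := @bihomogX k (bmon (ord0 : 'I_1, j)); rewrite bideg_bmon.
have z_eq0 (l : 'I_4) : (2 <= l)%N -> z l = 0.
  move=> l2; rewrite /z big1 // => j _; rewrite mxE big1 ?scale0r // => m _.
  rewrite mxE; case: eqP => [->|_]; last by rewrite mulr0.
  by rewrite ltnNge l2 mulr0.
have [zu zv] : z i_u = 0 /\ z i_v = 0 by split; apply: z_eq0.
pose f j := \sum_i P j i *: p i.
have hf j : bihomog a b (f j).
  by apply: bihomog_sum => i _; apply: bihomogZ.
pose V (f0 f1 f2 f3 : {mpoly k[4]}) := tnth [tuple f0; f1; f2; f3].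
have pair0 : z i_s * f i_s + z i_t * f i_t = 0.
  by move: Qp; rewrite QE change_pairing sum4E zu zv !mul0r !addr0.
have indep l m : bihomog 0 1 l -> bihomog 0 1 m -> l * f i_s + m * f i_t = 0 ->
    l = 0 /\ m = 0.
  move=> hl hm lm.
  (* A nonzero entry would make (l, m, 0, 0), after the change of basis, a syzygy of bidegree (0,
     1). *)
  have no_syz j : V l m 0 0 j = 0.
    apply/eqP; apply: contraPT isT => Vj; have [_] := hlin (change P (V l m 0 0)).
    case; apply: is_syzygy_change Pu Vj _ _.
      by apply: ord4P => //; apply: bihomog0.
    by rewrite sum4E !mul0r !addr0.
  by split; [have := no_syz i_s | have := no_syz i_t].
have Xu0 : 'X_i_u != 0 :> {mpoly k[4]} by rewrite -msupp_eq0 msuppX.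
(* Otherwise (u, 0) would be a linear relation between the first two new generators; symmetrically
   (0, u) for the second. *)
have f0_neq0 : f i_s != 0.
  apply/eqP => f0; have [] := indep 'X_i_u 0 (@bihomogXu k) (@bihomog0 k _ _).
    by rewrite f0 mulr0 mul0r addr0.
  by move/eqP; rewrite (negPf Xu0).
have f1_neq0 : f i_t != 0.
  apply/eqP => f1; have [] := indep 0 'X_i_u (@bihomog0 k _ _) (@bihomogXu k).
    by rewrite f1 mulr0 mul0r addr0.
  by move=> _ /eqP; rewrite (negPf Xu0).
have z01 : z i_s = 0 -> z i_t = 0 -> False.
  move=> zs zt; apply: Q0; apply/ffunP => i; rewrite QE !ffunE sum4E.
  by rewrite zs zt zu zv !scaler0 !addr0.
(* If one of the two quadrics vanishes, [pair0] and the nonvanishing of the f_j force the other to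
   vanish, against Q being nonzero. *)
have z0_neq0 : z i_s != 0.
  apply/eqP => zs; apply: z01 => //; apply: (mulIf f1_neq0).
  by move: pair0; rewrite zs !mul0r add0r.
have z1_neq0 : z i_t != 0.
  apply/eqP => zt; apply: z01 => //; apply: (mulIf f0_neq0).
  by move: pair0; rewrite zt !mul0r addr0.
have [cubic [q [hq f0E f1E]]] := quadric_syzygy (hz i_s) (hz i_t) (hf i_s) (hf i_t)
  z0_neq0 z1_neq0 pair0 indep.
have q_neq0 : q != 0 by apply: contra_neq f0_neq0; rewrite f0E => ->; rewrite mul0r.
have comb w : bihomog a b w -> exists l m,
    [/\ bihomog a (b - 2) l, bihomog a (b - 2) m & w = l * z i_t + m * (- z i_s)].
  apply: combination_ge3 hb => w' /cubic [l [m [hl hm ->]]].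
  by exists l, m; split; rewrite // mulrN.
have [l2 [m2 [hl2 hm2 f2E]]] := comb _ (hf i_u).
have [l3 [m3 [hl3 hm3 f3E]]] := comb _ (hf i_v).
(* The generators Q, S_1, S_2 in the new coordinates. *)
pose G := tnth [tuple z; V l2 m2 (- q) 0; V l3 m3 0 (- q)].
have hN := bihomogN hq.
have syz1 : is_syzygy p a (b - 2) (change P (V l2 m2 (- q) 0)).
  apply: (is_syzygy_change (j := i_u)) => //; first by rewrite oppr_eq0.
    by apply: ord4P => //; apply: bihomog0.
  rewrite sum4E; transitivity (l2 * f i_s + m2 * f i_t + - q * f i_u + 0 * f i_v) => //.
  by rewrite f0E f1E f2E; ring.
have syz2 : is_syzygy p a (b - 2) (change P (V l3 m3 0 (- q))).
  apply: (is_syzygy_change (j := i_v)) => //; first by rewrite oppr_eq0.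
    by apply: ord4P => //; apply: bihomog0.
  rewrite sum4E; transitivity (l3 * f i_s + m3 * f i_t + 0 * f i_u + - q * f i_v) => //.
  by rewrite f0E f1E f3E; ring.
exists (change P (V l2 m2 (- q) 0)), (change P (V l3 m3 0 (- q))); split=> //.
have gE j : tnth [tuple Q; change P (V l2 m2 (- q) 0); change P (V l3 m3 0 (- q))] j
    = change P (G j).
  by rewrite QE; case: j => [[|[|[|]]]].
(* The generators have bidegrees (c, d), and (c', d') are the complements to (2a - 1, b - 1); no
   subtraction truncates, as a is at least 1 and b at least 3. The count is 2a (b - 2) + 2a + 2a. *)
pose c := tnth [tuple 0; a; a]%N; pose d := tnth [tuple 2; b - 2; b - 2]%N.
pose c' := tnth [tuple 2 * a - 1; a - 1; a - 1]%N.
pose d' := tnth [tuple b - 3; 1; 1]%N.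
have <- : (\sum_j (c' j).+1 * (d' j).+1 = 2 * a * b)%N.
  by rewrite !big_ord_recl big_ord0 /c' /d' !(tnth_nth 0%N) /=; nia.
apply: (has_dim_free_submodule (c := c) (d := d)).
- move=> r r0.
  have rG : forall l, \sum_j r j * G j l = 0.
    apply: change_eq0 Pu _ => i; rewrite -change_sum -[RHS](r0 i).
    by apply: eq_bigr => j _; rewrite gE.
  (* The third and fourth coordinates each contain a single term, a coefficient of S_1 or S_2 times
     -q, so these coefficients vanish; the first coordinate then leaves the coefficient of Q times
     the nonzero [z i_s]. *)
  have E0 := rG i_s; have E2 := rG i_u; have E3 := rG i_v; move: E0 E2 E3.
  rewrite !big_ord_recl !big_ord0 /G !(tnth_nth z) /= /V !(tnth_nth 0) /=.
  rewrite zu zv !(mulr0, addr0, add0r) => E0 E2 E3.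
  have nq : - q != 0 by rewrite oppr_eq0.
  have r1 : r (lift ord0 ord0) = 0 by apply: (mulIf nq); rewrite E2 mul0r.
  have r2 : r (lift ord0 (lift ord0 ord0)) = 0 by apply: (mulIf nq); rewrite E3 mul0r.
  have r3 : r ord0 = 0.
    by apply: (mulIf z0_neq0); rewrite mul0r -[RHS]E0 r1 r2 !mul0r !addr0.
  by move=> [[|[|[|j]]] lt_j] //; [rewrite -[RHS]r3|rewrite -[RHS]r1|rewrite -[RHS]r2];
    congr r; apply: val_inj.
- case: syz1 syz2 => [_ _ hS1] [_ _ hS2] j i.
  rewrite /c /d !(tnth_nth 0%N) (tnth_nth Q).
  by case: j => [[|[|[|j]]] lt_j] /=.
- by move=> [[|[|[|j]]] lt_j] //; rewrite /c /c' !(tnth_nth 0%N) /=; lia.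
- by move=> [[|[|[|j]]] lt_j] //; rewrite /d /d' !(tnth_nth 0%N) /=; lia.
Qed.
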